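(* Let $\mathcal D\subset\mathbb C^k$ be a finite set with $n$ elements, let $S$ be a set of monomials in $\mathbb C[z_1,\dots,z_k]$ with $\#S=\#\mathcal D=n$, let $\mathcal P=\operatorname{Span}_{\mathbb C}(S)$, and assume that the pair $(\mathcal D,\mathcal P)$ is correct. Let $\lambda$ be a measure on $\mathbb C^k$ with finite moments (so that every $s\in S$ is $\lambda$-integrable). Let $X_{\mathcal D,S}=[s(d)]_{d\in\mathcal D,\,s\in S}$ be the evaluation matrix of the elements of $S$ over $\mathcal D$. Then, for a weight vector $w_S\in\mathbb C^n$ (indexed by $\mathcal D$), the cubature rule $(\mathcal D,w_S)$ is exact on $\mathcal P$ if and only if $$w_S=\left(X_{\mathcal D,S}^t\right)^{-1}\left[\int_{\mathbb C^k}s\,d\lambda\right]_{s\in S}.$$ Furthermore, the weights $w_S$ are unique.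
   Context: A cubature rule $(\mathcal D,w)$ consists of a finite set of nodes $\mathcal D\subset\mathbb C^k$ with $n$ elements and a weight vector $w=[w_d]_{d\in\mathcal D}$; it approximates $\int_{\mathbb C^k} g\,d\lambda$ by $\sum_{d\in\mathcal D}w_d\,g(d)$. It is exact on (for) a set $\mathcal P$ of polynomials if $\int_{\mathbb C^k}p\,d\lambda=\sum_{d\in\mathcal D}w_d\,p(d)$ for all $p\in\mathcal P$. The pair $(\mathcal D,\mathcal P)$ is called correct if for every function $g:\mathbb C^k\to\mathbb C$ there is a unique $p\in\mathcal P$ with $p(d)=g(d)$ for all $d\in\mathcal D$; for $\mathcal P=\operatorname{Span}_{\mathbb C}(S)$ with $S$ a set of monomials this is equivalent to the matrix $X_{\mathcal D,S}=[s(d)]_{d\in\mathcal D,s\in S}$ being square and non-singular. The superscript $t$ denotes transpose (without conjugation). *)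

(* Defs.v *)
(* The notations of [mpoly] clash with those of [all_analysis], so only its
   canonical structures and coercions are imported. *)
From mathcomp Require Import all_boot all_order all_algebra.
From mathcomp Require Import finmap complex.
From mathcomp Require Import all_classical all_reals all_analysis.
From mathcomp Require mpoly.
Import (canonicals, coercions) mpoly.

Set Implicit Arguments.
Unset Strict Implicit.
Unset Printing Implicit Defensive.

Import Order.TTheory GRing.Theory Num.Theory.
Import numFieldNormedType.Exports.

Local Open Scope classical_set_scope.
Local Open Scope fset_scope.
Local Open Scope ring_scope.

(* [R[i]] carries no topology by itself; it gets the one induced by the modulus
   when it is seen as a [numClosedFieldType]. *)
Definition Cplx (R : realType) : numClosedFieldType := R[i].

Definition Cspace (R : realType) (k : nat) := 'rV[Cplx R]_k.

Definition borelCspace (R : realType) (k : nat) :=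
  g_sigma_algebraType (@open 'rV[Cplx R]_k).

(* A monomial is represented by its exponent [m : multinom k]. *)
Definition monomial (R : realType) (k : nat) (m : mpoly.multinom k) :
    mpoly.mpoly k (Cplx R) := mpoly.mpolyX (Cplx R) m.

Definition peval (R : realType) (k : nat) (p : mpoly.mpoly k (Cplx R))
    (z : Cspace R k) : Cplx R := mpoly.meval (fun i => z ord0 i) p.

Definition span_monomials (R : realType) (k : nat)
    (S : {fset mpoly.multinom k}) : set (mpoly.mpoly k (Cplx R)) :=
  [set p | exists c : mpoly.multinom k -> Cplx R,
             p = \sum_(m <- S) c m *: monomial R m].
Arguments span_monomials R {k} S.

Definition cintegrable (R : realType) (k : nat)
    (lam : {measure set (borelCspace R k) -> \bar R})
    (f : Cspace R k -> Cplx R) : Prop :=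
  lam.-integrable setT (fun z : borelCspace R k => (complex.Re (f z))%:E) /\
  lam.-integrable setT (fun z : borelCspace R k => (complex.Im (f z))%:E).

Definition cintegral (R : realType) (k : nat)
    (lam : {measure set (borelCspace R k) -> \bar R})
    (f : Cspace R k -> Cplx R) : Cplx R :=
  Complex (Rintegral lam setT (fun z : borelCspace R k => complex.Re (f z)))
          (Rintegral lam setT (fun z : borelCspace R k => complex.Im (f z))).

(* It is enough to consider holomorphic monomials: mixed moments in [z] and its
   conjugate have the same absolute values. *)
Definition finite_moments (R : realType) (k : nat)
    (lam : {measure set (borelCspace R k) -> \bar R}) : Prop :=
  forall m : mpoly.multinom k, cintegrable lam (peval (monomial R m)).

Definition correct (R : realType) (k : nat) (D : {fset Cspace R k})
    (P : set (mpoly.mpoly k (Cplx R))) : Prop :=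
  forall g : Cspace R k -> Cplx R,
    exists! p, P p /\ forall d, d \in D -> peval p d = g d.

(* Vectors and matrices indexed by a finite set with [n] elements are indexed by
   ['I_n] through the canonical enumeration of that set; the default value of
   [nth] is only reached when the cardinal is smaller than [n]. *)
Definition node (R : realType) (k n : nat) (D : {fset Cspace R k})
    (i : 'I_n) : Cspace R k := nth 0 (enum_fset D) i.

Definition monomial_at (R : realType) (k n : nat)
    (S : {fset mpoly.multinom k}) (j : 'I_n) : mpoly.mpoly k (Cplx R) :=
  monomial R (nth (@mpoly.mnm0 k) (enum_fset S) j).

Definition eval_matrix (R : realType) (k n : nat) (D : {fset Cspace R k})
    (S : {fset mpoly.multinom k}) : 'M[Cplx R]_n :=
  \matrix_(i < n, j < n) peval (monomial_at R S j) (node D i).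

Definition moment_vector (R : realType) (k n : nat)
    (lam : {measure set (borelCspace R k) -> \bar R})
    (S : {fset mpoly.multinom k}) : 'cV[Cplx R]_n :=
  \col_(j < n) cintegral lam (peval (monomial_at R S j)).

Definition cubature_exact (R : realType) (k n : nat)
    (lam : {measure set (borelCspace R k) -> \bar R})
    (D : {fset Cspace R k}) (w : 'cV[Cplx R]_n)
    (P : set (mpoly.mpoly k (Cplx R))) : Prop :=
  forall p, P p ->
    cintegral lam (peval p) = \sum_(i < n) w i ord0 * peval p (node D i).

(* Main.v *)
Require Import Defs.
From mathcomp Require Import all_boot all_order all_algebra.
From mathcomp Require Import finmap complex.
From mathcomp Require Import all_classical all_reals all_analysis.
From mathcomp Require mpoly.
Import (canonicals, coercions) mpoly.

Import Order.TTheory GRing.Theory Num.Theory.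
Import numFieldNormedType.Exports.

Local Open Scope classical_set_scope.
Local Open Scope fset_scope.
Local Open Scope ring_scope.

(** Write [X] for the evaluation matrix, whose rows are indexed by the nodes and
    whose columns are indexed by the monomials of [S].

    A polynomial of the span is [\sum_j c_j s_j], and its values at the nodes are
    the entries of [X *m c] ([eval_matrixE]). Correctness says in particular that
    the indicator function of each node is interpolated by such a polynomial; the
    coefficient vectors of these interpolants are the columns of a right inverse
    of the square matrix [X], so [X] is invertible ([eval_matrix_unit]).

    Both sides of the exactness condition are linear in the polynomial: the
    cubature sum obviously, the integral because all the monomials are integrable
    ([cintegral_sum]). Exactness on the span therefore reduces to exactness on
    each [s_j], and these [n] equations are the linear system
    [X^T *m w = moments] ([cubature_exactP]). As [X^T] is invertible, the system
    has exactly one solution, the one in the theorem.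

    The integral of a complex function is given by its real and imaginary parts,
    and a complex scalar mixes the two parts: each part of [a * f + g] is a real
    combination of three real functions. This is why complex linearity rests on
    statements about real combinations of three terms. *)

(** * Linearity of the complex integral *)

Lemma Re_lincomb (R : realType) (a x y : Cplx R) :
  complex.Re (a * x + y) =
  complex.Re a * complex.Re x + - complex.Im a * complex.Im x + complex.Re y.
Proof. by case: a x y => [? ?] [? ?] [? ?]; rewrite /= mulNr. Qed.

Lemma Im_lincomb (R : realType) (a x y : Cplx R) :
  complex.Im (a * x + y) =
  complex.Re a * complex.Im x + complex.Im a * complex.Re x + complex.Im y.
Proof. by case: a x y => [? ?] [? ?] [? ?]. Qed.

Lemma integrable_lincomb3 d (T : measurableType d) (R : realType)
    (mu : {measure set T -> \bar R}) (u v w : T -> R) (a b : R) :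
  mu.-integrable setT (EFin \o u) -> mu.-integrable setT (EFin \o v) ->
  mu.-integrable setT (EFin \o w) ->
  mu.-integrable setT (fun x => (a * u x + b * v x + w x)%:E).
Proof.
move=> iu iv iw.
have := integrableD measurableT
  (integrableD measurableT (integrableZl measurableT a iu)
                           (integrableZl measurableT b iv)) iw.
by apply: eq_integrable.
Qed.

Lemma Rintegral_lincomb3 d (T : measurableType d) (R : realType)
    (mu : {measure set T -> \bar R}) (u v w : T -> R) (a b : R) :
  mu.-integrable setT (EFin \o u) -> mu.-integrable setT (EFin \o v) ->
  mu.-integrable setT (EFin \o w) ->
  Rintegral mu setT (fun x => a * u x + b * v x + w x) =
  a * Rintegral mu setT u + b * Rintegral mu setT v + Rintegral mu setT w.
Proof.
move=> iu iv iw.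
have iau : mu.-integrable setT (EFin \o (fun x => a * u x)).
  by have := integrableZl measurableT a iu; apply: eq_integrable.
have ibv : mu.-integrable setT (EFin \o (fun x => b * v x)).
  by have := integrableZl measurableT b iv; apply: eq_integrable.
have iauv : mu.-integrable setT (EFin \o (fun x => a * u x + b * v x)).
  by have := integrableD measurableT iau ibv; apply: eq_integrable.
by rewrite (RintegralD measurableT iauv iw)
  (RintegralD measurableT iau ibv) !RintegralZl.
Qed.

Section ComplexIntegral.
Context (R : realType) (k : nat)
  (lam : {measure set (borelCspace R k) -> \bar R}).
Implicit Types f g : Cspace R k -> Cplx R.

Lemma cintegrable_lincomb (a : Cplx R) f g :
  cintegrable lam f -> cintegrable lam g ->
  cintegrable lam (fun z => a * f z + g z).
Proof.
move=> [rf jf] [rg jg]; split.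
  rewrite (_ : (fun z => _) = fun z => (complex.Re a * complex.Re (f z)
    + - complex.Im a * complex.Im (f z) + complex.Re (g z))%:E); last first.
    by apply/funext => z; rewrite Re_lincomb.
  exact: integrable_lincomb3.
rewrite (_ : (fun z => _) = fun z => (complex.Re a * complex.Im (f z)
  + complex.Im a * complex.Re (f z) + complex.Im (g z))%:E); last first.
  by apply/funext => z; rewrite Im_lincomb.
exact: integrable_lincomb3.
Qed.

Lemma cintegral_lincomb (a : Cplx R) f g :
  cintegrable lam f -> cintegrable lam g ->
  cintegral lam (fun z => a * f z + g z) =
  a * cintegral lam f + cintegral lam g.
Proof.
move=> [rf jf] [rg jg]; apply/eqP; rewrite eq_complex Re_lincomb Im_lincomb /=.
rewrite -!Rintegral_lincomb3 //; apply/andP; split; apply/eqP.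
  by congr (Rintegral _ _); apply/funext => z; rewrite Re_lincomb.
by congr (Rintegral _ _); apply/funext => z; rewrite Im_lincomb.
Qed.

Lemma cintegrable0 : cintegrable lam (fun=> 0).
Proof. by split; apply: (integrable0 lam setT). Qed.

Lemma cintegral0 : cintegral lam (fun=> 0) = 0.
Proof.
by apply/eqP; rewrite eq_complex /= /Rintegral integral0 eqxx.
Qed.

Lemma cintegrable_sum (I : Type) (r : seq I) (c : I -> Cplx R)
    (f : I -> Cspace R k -> Cplx R) :
  (forall i, cintegrable lam (f i)) ->
  cintegrable lam (fun z => \sum_(i <- r) c i * f i z).
Proof.
move=> If; elim: r => [|i r IHr].
  by under eq_fun do rewrite big_nil; apply: cintegrable0.
by under eq_fun do rewrite big_cons; apply: cintegrable_lincomb.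
Qed.

Lemma cintegral_sum (I : Type) (r : seq I) (c : I -> Cplx R)
    (f : I -> Cspace R k -> Cplx R) :
  (forall i, cintegrable lam (f i)) ->
  cintegral lam (fun z => \sum_(i <- r) c i * f i z) =
  \sum_(i <- r) c i * cintegral lam (f i).
Proof.
move=> If; elim: r => [|i r IHr].
  by under eq_fun do rewrite big_nil; rewrite cintegral0 big_nil.
under eq_fun do rewrite big_cons.
by rewrite cintegral_lincomb ?IHr ?big_cons//; apply: cintegrable_sum.
Qed.

End ComplexIntegral.

(** * Polynomials of the span and the evaluation matrix *)

Lemma peval_sum (R : realType) (k : nat) (I : Type) (r : seq I)
    (c : I -> Cplx R) (p : I -> mpoly.mpoly k (Cplx R)) (z : Cspace R k) :
  peval (\sum_(i <- r) c i *: p i) z = \sum_(i <- r) c i * peval (p i) z.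
Proof.
by rewrite /peval raddf_sum; apply: eq_bigr => i _; rewrite /= mpoly.mevalZ.
Qed.

(** Passes from coefficients that are functions of the exponent to coefficient
    vectors, on which matrices act. *)
Lemma span_monomialsP (R : realType) (k n : nat)
    (S : {fset mpoly.multinom k}) (p : mpoly.mpoly k (Cplx R)) :
  #|` S| = n ->
  span_monomials R S p <->
  exists c : 'cV[Cplx R]_n, p = \sum_(j < n) c j ord0 *: monomial_at R S j.
Proof.
move=> <-; split=> [[c ->]|[c ->]].
  exists (\col_j c (nth (@mpoly.mnm0 k) (enum_fset S) j)).
  rewrite (big_nth (@mpoly.mnm0 k)) big_mkord.
  by apply: eq_bigr => j _; rewrite mxE.
(* Since [S] is enumerated without repetition, the coefficient of an exponent is
   found at its index in the enumeration; exponents outside [S] get 0. *)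
exists (fun m => if insub (index m (enum_fset S)) is Some j
                 then c j ord0 else 0).
rewrite [RHS](big_nth (@mpoly.mnm0 k)) big_mkord.
by apply: eq_bigr => j _; rewrite index_uniq ?fset_uniq// valK.
Qed.
Arguments span_monomialsP {R k n S} p _.

Lemma eval_matrixE (R : realType) (k n : nat) (D : {fset Cspace R k})
    (S : {fset mpoly.multinom k}) (c : 'cV[Cplx R]_n) (i : 'I_n) :
  peval (\sum_(j < n) c j ord0 *: monomial_at R S j) (node D i) =
  (eval_matrix n D S *m c) i ord0.
Proof.
rewrite peval_sum mxE; apply: eq_bigr => j _.
by rewrite mxE mulrC.
Qed.

(** Interpolating the indicator functions of the nodes gives a right inverse, and
    a right inverse of a square matrix over a commutative ring is an inverse. *)
Lemma eval_matrix_unit (R : realType) (k n : nat) (D : {fset Cspace R k})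
    (S : {fset mpoly.multinom k}) :
  #|` D| = n -> #|` S| = n -> correct D (span_monomials R S) ->
  eval_matrix n D S \in unitmx.
Proof.
move=> hD hS hc.
(* [C l] holds the coefficients of the Lagrange polynomial of node [l]. *)
have /choice[C hC] : forall l : 'I_n, exists c : 'cV[Cplx R]_n,
    eval_matrix n D S *m c = delta_mx l ord0.
  move=> l; have [p [[/(span_monomialsP _ hS)[c ->] hp] _]] :=
    hc (fun d => (d == node D l)%:R).
  exists c; apply/colP => i; rewrite -eval_matrixE hp; last first.
    by apply: mem_nth; rewrite -[size _]/(#|` D|) hD.
  by rewrite mxE eqxx andbT nth_uniq ?fset_uniq// -[size _]/(#|` D|) hD.
have : eval_matrix n D S *m (\matrix_(i, l) C l i ord0) = 1%:M.
  apply/matrixP => i l; have /colP/(_ i) := hC l.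
  by rewrite !mxE eqxx andbT => <-; apply: eq_bigr => j _; rewrite !mxE.
by case/mulmx1_unit.
Qed.

(** * Exactness as a linear system *)

(** Testing exactness on the monomials gives one equation for each row of the
    system; by linearity of the integral these equations give exactness on all
    their combinations. *)
Lemma cubature_exactP (R : realType) (k n : nat) (D : {fset Cspace R k})
    (S : {fset mpoly.multinom k}) (hS : #|` S| = n)
    (lam : {measure set (borelCspace R k) -> \bar R})
    (hlam : finite_moments lam) (w : 'cV[Cplx R]_n) :
  cubature_exact lam D w (span_monomials R S) <->
  (eval_matrix n D S)^T *m w = moment_vector n lam S.
Proof.
have tE j : ((eval_matrix n D S)^T *m w) j ord0 =
    \sum_(i < n) w i ord0 * peval (monomial_at R S j) (node D i).
  by rewrite mxE; apply: eq_bigr => i _; rewrite !mxE mulrC.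
split=> [ex|/colP mom p /(span_monomialsP _ hS)[c ->]].
  apply/colP => j; rewrite tE mxE ex//.
  apply/(span_monomialsP _ hS).
  exists (delta_mx j ord0); rewrite (bigD1 j)//= mxE !eqxx scale1r.
  by rewrite big1 ?addr0// => l /negPf ne; rewrite mxE ne scale0r.
rewrite (_ : peval _ = fun z =>
  \sum_(j < n) c j ord0 * peval (monomial_at R S j) z); last first.
  by apply/funext => z; rewrite peval_sum.
rewrite cintegral_sum => [|j]; last exact: hlam.
under [RHS]eq_bigr do rewrite mulr_sumr.
rewrite exchange_big; apply: eq_bigr => j _ /=.
have := mom j; rewrite tE mxE => <-; rewrite mulr_sumr.
by apply: eq_bigr => i _; rewrite mulrCA.
Qed.

Theorem proposition1 (R : realType) (k n : nat)
    (D : {fset Cspace R k}) (hD : #|` D| = n)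
    (S : {fset mpoly.multinom k}) (hS : #|` S| = n)
    (hcorrect : correct D (span_monomials R S))
    (lam : {measure set (borelCspace R k) -> \bar R})
    (hlam : finite_moments lam) :
  [/\ (eval_matrix n D S)^T \in unitmx,
      forall w : 'cV[Cplx R]_n,
        cubature_exact lam D w (span_monomials R S) <->
        w = invmx (eval_matrix n D S)^T *m moment_vector n lam S
    & exists! w : 'cV[Cplx R]_n,
        cubature_exact lam D w (span_monomials R S)].
Proof.
have unitX : (eval_matrix n D S)^T \in unitmx.
  by rewrite unitmx_tr eval_matrix_unit.
have exactE (w : 'cV[Cplx R]_n) :
    cubature_exact lam D w (span_monomials R S) <->
    w = invmx (eval_matrix n D S)^T *m moment_vector n lam S.
  rewrite cubature_exactP//; split=> [<-|->]; first by rewrite mulKmx.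
  by rewrite mulKVmx.
split=> //; exists (invmx (eval_matrix n D S)^T *m moment_vector n lam S).
by split=> [|w /exactE ->//]; apply/exactE.
Qed.
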